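(* Let $M$ be a quaternary matroid on finite ground set $V$, viewed as the set system $(V,\mathcal{B})$ of its bases, and let $A$ be a matrix over $GF(4)$ with columns indexed by $V$ representing $M$ (i.e. $M=M(\ker(A))$). Then the matroid $M(\mathcal{BC}_{\ker(A)})$, described by its bases, equals the set system $\max(M+V)$. In particular, $M(\mathcal{BC}_{\ker(A)})$ depends only on $M$ and not on the chosen representation $A$.
   Context: For a subspace $L\subseteq GF(4)^V$, $M(L)$ is the matroid on $V$ whose circuits are the inclusion-minimal nonempty sets $X\subseteq V$ that are the support of some vector of $L$ (the support of $v$ is the set of coordinates where $v$ is nonzero). $\mathrm{inv}$ is the nontrivial field automorphism $x\mapsto x^2$ of $GF(4)$, applied coordinatewise to vectors and elementwise to subspaces. $L^\perp$ is the orthogonal complement of $L$ with respect to the standard bilinear form $\sum_i x_iy_i$. The bicycle space of $L$ is $\mathcal{BC}_L=L\cap\mathrm{inv}(L^\perp)$. For a set system $M=(V,E)$ (with $E\subseteq 2^V$), $M+V=(V,E')$ where $X\in E'$ iff $|\{Z\in E\mid Z\subseteq X\}|$ is odd (equivalently, apply loop complementation $+u$ for each $u\in V$, where $M+u=(V,E\triangle\{Y\cup\{u\}\mid Y\in E,u\notin Y\})$). $\max(M)=(V,\max(E))$ where $\max(E)$ is the family of inclusion-maximal members of $E$. *)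

(* Defs.v *)
From HB Require Import structures.
From mathcomp Require Import all_boot all_order all_algebra.
From mathcomp Require Import finfield.

Set Implicit Arguments.
Unset Strict Implicit.
Unset Printing Implicit Defensive.

Import GRing.Theory.
Local Open Scope ring_scope.

Section SetSystems.
Variable V : finType.
Implicit Types (E : {set {set V}}) (X Y Z : {set V}).

(* The set system M + V. *)
Definition loopcV E : {set {set V}} :=
  [set X : {set V} | odd #|[set Z : {set V} in E | Z \subset X]|].

Definition maxsys E : {set {set V}} := [set X : {set V} | maxset (mem E) X].

(* Circuit axioms: no empty circuit, incomparability, weak elimination. *)
Definition circuit_axioms E : bool :=
  [&& set0 \notin E,
      [forall X in E, forall Y in E, (X \subset Y) ==> (X == Y)]
    & [forall X in E, forall Y in E, forall e in X :&: Y,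
        (X != Y) ==> [exists Z in E, Z \subset (X :|: Y) :\ e]]].

Record matroid := Matroid {
  circuits : {set {set V}};
  circuitsP : circuit_axioms circuits
}.

Definition indep (M : matroid) X : bool :=
  [forall C in circuits M, ~~ (C \subset X)].

Definition bases (M : matroid) : {set {set V}} :=
  [set X : {set V} | maxset (indep M) X].

Lemma matroid_inj : injective circuits.
Proof.
move=> [C1 h1] [C2 h2] /= e; move: h1 h2; rewrite e => h1 h2.
by rewrite (bool_irrelevance h1 h2).
Qed.

End SetSystems.

Section Subspaces.
Variables (F : finFieldType) (V : finType).
Notation vec := {ffun V -> F^o}.
Implicit Types (x y : vec) (L : {vspace vec}).

Definition supp x : {set V} := [set v | x v != 0].

Definition min_supports L : {set {set V}} :=
  [set X : {set V} | minset (fun Y => (Y != set0) &&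
                            [exists x : vec, (x \in L) && (supp x == Y)]) X].

Lemma supp_eq0 x : (supp x == set0) = (x == 0).
Proof.
apply/eqP/eqP => [/setP h|->]; last by apply/setP=> v; rewrite !inE ffunE eqxx.
apply/ffunP=> v; rewrite ffunE; apply/eqP.
by have := h v; rewrite !inE => /negbFE.
Qed.

Lemma min_supportsP L X :
  reflect [/\ X != set0, exists2 x, x \in L & supp x = X
            & forall x, x \in L -> x != 0 -> supp x \subset X -> supp x = X]
          (X \in min_supports L).
Proof.
rewrite inE; apply: (iffP minsetP) => [[/andP[X0 /existsP[x /andP[xL /eqP sx]]]] h|].
  split=> //; first by exists x.
  move=> y yL y0 sy; apply: h => //; rewrite supp_eq0 y0 /=.
  by apply/existsP; exists y; rewrite yL /=.
move=> [X0 [x xL sx] h]; split.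
  by rewrite X0; apply/existsP; exists x; rewrite xL sx /=.
move=> Y /andP[Y0 /existsP[y /andP[yL /eqP sy]]] YX.
by rewrite -sy; apply: h; rewrite ?sy // -supp_eq0 sy.
Qed.

Lemma min_supports_below L x : x \in L -> x != 0 ->
  exists2 Z, Z \in min_supports L & Z \subset supp x.
Proof.
move=> xL x0.
have [|Z mZ sZ] := @minset_exists _ (fun Y => (Y != set0) &&
  [exists x : vec, (x \in L) && (supp x == Y)]) (supp x).
  by rewrite supp_eq0 x0; apply/existsP; exists x; rewrite xL /=.
by exists Z => //; rewrite inE.
Qed.

Lemma min_supports_axioms L : circuit_axioms (min_supports L).
Proof.
apply/and3P; split.
- by apply/negP => /min_supportsP[]; rewrite eqxx.
- apply/forall_inP => X /min_supportsP[X0 [x xL sx] _].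
  apply/forall_inP => Y /min_supportsP[_ _ h]; apply/implyP => XY.
  by rewrite -sx (h x) ?sx // -supp_eq0 sx.
apply/forall_inP => X /min_supportsP[X0 [x xL sx] hX].
apply/forall_inP => Y /min_supportsP[Y0 [y yL sy] hY].
apply/forall_inP => e /setIP[eX eY]; apply/implyP => XY.
have [f fX fY] : exists2 f, f \in X & f \notin Y.
  apply/subsetPn; apply: contra XY => XY; rewrite -sx; apply/eqP.
  by apply: hY => //; rewrite ?sx // -supp_eq0 sx.
pose z : vec := y e *: x - x e *: y.
have zL : z \in L by rewrite memvB ?memvZ.
have zE v : z v = y e * x v - x e * y v by rewrite !ffunE.
have [xf yf ye] : [/\ x f != 0, y f = 0 & y e != 0].
  move: fX fY eY; rewrite -sx -sy !inE negbK => ? /eqP ? ?; by split.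
have z0 : z != 0.
  apply/eqP => /ffunP/(_ f); rewrite zE yf mulr0 subr0 ffunE => /eqP.
  by rewrite mulf_eq0 (negPf ye) (negPf xf).
have [Z ZL sZ] := min_supports_below zL z0.
apply/existsP; exists Z; rewrite ZL /=; apply: (subset_trans sZ).
apply/subsetP => v; rewrite !inE zE -sx -sy !inE => nz; apply/andP; split.
  by apply: contraNneq nz => ->; rewrite mulrC subrr.
by apply: contraNT nz; rewrite negb_or !negbK => /andP[/eqP-> /eqP->];
  rewrite !mulr0 subr0.
Qed.

(* The matroid M(L). *)
Definition matroid_of L : matroid V := Matroid (min_supports_axioms L).

Definition dot x y : F := \sum_v x v * y v.

Definition mulmxv (I : finType) (A : I -> V -> F) x : {ffun I -> F^o} :=
  [ffun i => \sum_v A i v * x v].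

Definition ker (I : finType) (A : I -> V -> F) : {vspace vec} :=
  lker (linfun (mulmxv A)).

Definition perp L : {vspace vec} :=
  (\bigcap_(x in L) lker (linfun (dot x : vec -> F^o)))%VS.

Definition inv x : vec := [ffun v => x v ^+ 2].

(* Over GF(4) the span is superfluous: see mem_invv. *)
Definition invv L : {vspace vec} := <<[seq inv x | x in L]>>%VS.

Definition bicycle L : {vspace vec} := (L :&: invv (perp L))%VS.

Lemma mulmxv_linear (I : finType) (A : I -> V -> F) : linear (mulmxv A).
Proof.
move=> a x y; apply/ffunP => i; rewrite !ffunE scaler_sumr -big_split /=.
by apply: eq_bigr => v _; rewrite !ffunE mulrDr mulrCA.
Qed.

Lemma dot_linear x : linear (dot x : vec -> F^o).
Proof.
move=> a y z; rewrite /dot scaler_sumr -big_split /=.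
by apply: eq_bigr => v _; rewrite !ffunE mulrDr mulrCA.
Qed.

Lemma mem_ker (I : finType) (A : I -> V -> F) x :
  (x \in ker A) = [forall i, \sum_v A i v * x v == 0].
Proof.
pose f := GRing.isLinear.Build _ _ _ _ _ (mulmxv_linear A).
pose g : {linear vec -> {ffun I -> F^o}} := HB.pack (mulmxv A) f.
rewrite memv_ker (lfunE g) /=; apply/eqP/forallP => [/ffunP h i|h].
  by have := h i; rewrite !ffunE => ->.
by apply/ffunP => i; rewrite !ffunE; apply/eqP.
Qed.

Lemma mem_perp L y : (y \in perp L) = [forall x in L, dot x y == 0].
Proof.
have h x : (y \in lker (linfun (dot x : vec -> F^o))) = (dot x y == 0).
  pose f := GRing.isLinear.Build _ _ _ _ _ (dot_linear x).
  pose g : {linear vec -> F^o} := HB.pack (dot x : vec -> F^o) f.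
  by rewrite memv_ker (lfunE g).
rewrite memvE; apply/subv_bigcapP/forall_inP => k x xL.
  by rewrite -h memvE k.
by rewrite -memvE h k.
Qed.

Lemma mem_invv L y : #|F| = 4%N ->
  reflect (exists2 x, x \in L & y = inv x) (y \in invv L).
Proof.
move=> F4; have F2 : 2%N \in [pchar F] by apply: (@card_finPcharP _ 2 2).
have invD : {morph inv : u v / u + v >-> u + v}.
  move=> u v; apply/ffunP => w; rewrite !ffunE.
  exact: (pFrobenius_autD_comm F2 (mulrC _ _)).
have inv0 : inv 0 = 0 by apply/ffunP => w; rewrite !ffunE expr0n.
have invK x : inv (inv x) = x.
  by apply/ffunP => w; rewrite !ffunE -exprM -[RHS]expf_card F4.
have invZ a x : inv (a *: x) = a ^+ 2 *: inv x.
  by apply/ffunP => w; rewrite !ffunE exprMn.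
apply: (iffP idP) => [yL|[x xL ->]]; last by apply/memv_span/image_f.
exists (inv y); last by rewrite invK.
rewrite (coord_span (X := in_tuple _) yL) (big_morph inv invD inv0).
apply: rpred_sum => i _; rewrite invZ rpredZ //.
have /imageP[x xL ->] := mem_nth 0 (ltn_ord i).
by rewrite invK.
Qed.

End Subspaces.

(* Main.v *)
(** Let [G] have as rows a basis of the orthogonal complement of [L = ker A], and
    write [x |-> x ^+ 2] for conjugation.  Since [d ^+ 3 = 1] for every nonzero
    [d] in GF(4), the Cauchy-Binet formula shows that the number of bases of [M]
    inside [X] is, modulo 2, the determinant of [G D_X G^*], where [D_X] is the
    coordinate projection onto [X].  Hence [X] belongs to [M + V] iff no nonzero
    [z] in [inv (perp L)] has its restriction to [X] in [L].  Such an [X]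
    contains no support of a nonzero bicycle, and conversely every basis of the
    bicycle matroid has this property, by pairing [z] with the bicycles. *)

Require Import Defs.
From mathcomp Require Import all_boot all_order all_algebra.
From mathcomp Require Import perm finfield.

Set Implicit Arguments.
Unset Strict Implicit.
Unset Printing Implicit Defensive.

Import GRing.Theory.

(** * The Cauchy-Binet formula *)

Section CauchyBinet.
Local Open Scope ring_scope.
Variables (R : comNzRingType) (V : finType) (r : nat) (A B : 'I_r -> V -> R).

(** Multilinearity in the rows: [f i] is the summand [v] picked in row [i]. *)
Lemma det_sum_mul :
  \det (\matrix_(i, j) \sum_v A i v * B j v) =
  \sum_(f : {ffun 'I_r -> V})
     (\prod_i A i (f i)) * \det (\matrix_(i, j) B j (f i)).
Proof.
rewrite /determinant.
under eq_bigr => s _.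
  under eq_bigr do rewrite mxE.
  rewrite bigA_distr_bigA /= big_distrr /=.
  under eq_bigr do rewrite big_split /= mulrCA.
  over.
rewrite exchange_big /=; apply: eq_bigr => f _; rewrite big_distrr /=.
apply: eq_bigr => s _; congr (_ * (_ * _)).
by apply: eq_bigr => i _; rewrite mxE.
Qed.

(** The [f] with the same image as [g] are the [g \o s] for permutations [s]. Reordering the rows of
    the [B] minor costs the sign of [s], and what remains is the Leibniz expansion of the [A]
    minor. *)
Lemma sum_det_same_image (g : 'I_r -> V) : injective g ->
  \sum_(f : {ffun 'I_r -> V} | f @: setT == g @: setT)
     (\prod_i A i (f i)) * \det (\matrix_(i, j) B j (f i)) =
  \det (\matrix_(i, j) A i (g j)) * \det (\matrix_(i, j) B i (g j)).
Proof.
move=> inj_g; pose h (s : 'S_r) : {ffun 'I_r -> V} := [ffun i => g (s i)].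
have inj_h : injective h.
  move=> s t /ffunP e; apply/permP => i; apply: inj_g.
  by have := e i; rewrite !ffunE.
have -> : \det (\matrix_(i, j) B i (g j)) = \det (\matrix_(i, j) B j (g i)).
  by rewrite -det_tr; congr determinant; apply/matrixP=> i j; rewrite !mxE.
rewrite {2}/determinant big_distrl /=.
transitivity (\sum_(f in h @: setT)
   (\prod_i A i (f i)) * \det (\matrix_(i, j) B j (f i))).
  apply: eq_bigl => f; apply/eqP/imsetP => [eZ|[s _ ->]]; last first.
    apply/setP => v; apply/imsetP/imsetP => [[i _ ->]|[i _ ->]].
      by exists (s i); rewrite ?ffunE.
    by exists ((s^-1)%g i); rewrite ?ffunE ?permKV.
  have inj_f : injective f.
    have /imset_injP inj : #|f @: setT| == #|[set: 'I_r]|.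
      by rewrite eZ card_imset.
    by move=> i j; apply: inj.
  have fg i : f i \in codom g.
    have : f i \in g @: setT by rewrite -eZ imset_f.
    by case/imsetP=> j _ ->; apply: codom_f.
  have inj_p : injective (fun i => iinv (fg i)).
    by move=> i j e; apply: inj_f; rewrite -(f_iinv (fg i)) e f_iinv.
  by exists (perm inj_p) => //; apply/ffunP => i; rewrite ffunE permE f_iinv.
rewrite big_imset /=; last by move=> s t _ _; apply: inj_h.
rewrite [LHS](eq_bigl predT); last by move=> s; rewrite inE.
apply: eq_bigr => s _.
have -> : \det (\matrix_(i, j) B j (h s i)) =
          (-1) ^+ s * \det (\matrix_(i, j) B j (g i)).
  rewrite -det_perm -det_mulmx; congr determinant.
  by rewrite -row_permE; apply/matrixP=> i j; rewrite !mxE ffunE.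
rewrite mulrA [_ * (-1) ^+ s]mulrC; congr (_ * _ * _).
by apply: eq_bigr => i _; rewrite mxE ffunE.
Qed.

(* [c Z] is the product of the two maximal minors on the columns [Z]; passing
   it as a function avoids choosing an ordering of [Z]. *)
Lemma cauchy_binet (c : {set V} -> R) :
    (forall Z : {set V}, #|Z| != r -> c Z = 0) ->
    (forall g, injective g -> c (g @: setT) =
       \det (\matrix_(i, j) A i (g j)) * \det (\matrix_(i, j) B i (g j))) ->
  \det (\matrix_(i, j) \sum_v A i v * B j v) = \sum_Z c Z.
Proof.
move=> c0 cg; rewrite det_sum_mul.
rewrite (partition_big (fun f : {ffun 'I_r -> V} => f @: setT) predT) //=.
apply: eq_bigr => Z _; have [cZ|ncZ] := eqVneq #|Z| r; last first.
  rewrite c0 // big1 // => f /eqP eZ.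
  (* An image of size other than [r] forces a collision of [f], hence two equal rows. *)
  have /negP ninj : ~~ injectiveb f.
    apply: contra ncZ => /injectiveP inj_f.
    by rewrite -eZ card_imset // cardsT card_ord.
  case/injectivePn: (introN idP ninj) => i [j nij eij].
  by rewrite (@determinant_alternate _ _ _ i j) ?mulr0 // => k; rewrite !mxE eij.
pose g i : V := enum_val (cast_ord (esym cZ) i).
have inj_g : injective g by move=> i j /enum_val_inj/cast_ord_inj.
have gZ : g @: setT = Z.
  apply/eqP; rewrite eqEcard card_imset // cardsT card_ord cZ leqnn andbT.
  by apply/subsetP=> _ /imsetP[i _ ->]; apply: enum_valP.
by rewrite -gZ cg // sum_det_same_image.
Qed.

End CauchyBinet.

(** * Recovering a matroid from its bases *)

Section MatroidBases.
Variable V : finType.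
Implicit Types (M N : matroid V) (X Y C : {set V}).

Lemma indep_sub M X Y : X \subset Y -> indep M Y -> indep M X.
Proof.
move=> sXY /forall_inP iY; apply/forall_inP => C /iY.
by apply: contra => /subset_trans; apply.
Qed.

Lemma indepP M X :
  reflect (exists2 Y : {set V}, Y \in bases M & X \subset Y) (indep M X).
Proof.
apply: (iffP idP) => [/maxset_exists[Y mY sXY]|[Y]].
  by exists Y; rewrite ?inE.
by rewrite inE => /maxsetp iY /indep_sub; apply.
Qed.

Lemma circuits_minset M X :
  (X \in circuits M) = minset (fun Y => ~~ indep M Y) X.
Proof.
have /and3P[_ /forall_inP incomp _] := circuitsP M.
have dep C : C \in circuits M -> ~~ indep M C.
  by move=> CM; apply/forall_inPn; exists C; rewrite ?negbK.
apply/idP/minsetP => [XM|[/forall_inPn[C CM]]].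
  split=> [|Y /forall_inPn[C CM]]; first exact: dep.
  rewrite negbK => sCY sYX; have /forall_inP/(_ X XM)/implyP := incomp C CM.
  move=> /(_ (subset_trans sCY sYX))/eqP eCX.
  by apply/eqP; rewrite eqEsubset sYX -eCX.
by rewrite negbK => sCX h; rewrite -(h C) ?dep.
Qed.

(** Independent sets are the subsets of bases and circuits are the minimal dependent sets, so bases
    determine circuits. *)
Lemma bases_inj : injective (@bases V).
Proof.
move=> M N eMN; apply: matroid_inj; apply/setP => X.
have eI Y : indep M Y = indep N Y.
  by apply/indepP/indepP; rewrite eMN.
rewrite !circuits_minset; apply/minsetP/minsetP; rewrite eI => -[dX h];
  by split=> // Y dY; apply: h; rewrite ?eI // -eI.
Qed.

End MatroidBases.

(** * Bases of a represented matroid as nonvanishing maximal minors *)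

Section RepresentedBases.
Local Open Scope ring_scope.
Variables (F : finFieldType) (V : finType).
Notation vec := {ffun V -> F^o}.
Implicit Types (x y z : vec) (L : {vspace vec}) (X : {set V}).

Lemma notin_supp x X v : supp x \subset X -> v \notin X -> x v = 0.
Proof.
move=> sX; apply: contraNeq => xv; apply: (subsetP sX); by rewrite inE.
Qed.

Lemma indep_matroid_ofP L X :
  reflect (forall x, x \in L -> supp x \subset X -> x = 0)
          (indep (matroid_of L) X).
Proof.
apply: (iffP forall_inP) => [h x xL sx|h C /min_supportsP[C0 [x xL sx] _]].
  apply/eqP/negPn/negP => x0; have [Z ZL sZ] := min_supports_below xL x0.
  by have := h Z ZL; rewrite (subset_trans sZ sx).
apply: contra C0 => sC; rewrite -sx supp_eq0; apply/eqP.
by apply: h; rewrite ?sx.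
Qed.

(** By maximality [c |: X] is dependent, and a nonzero vector of [L] supported there cannot vanish
    at [c], since [X] is independent. *)
Lemma fundamental_vector L X c :
    X \in bases (matroid_of L) -> c \notin X ->
  exists x, [/\ x \in L, supp x \subset c |: X & x c != 0].
Proof.
rewrite inE => /maxsetP[/indep_matroid_ofP iX mX] cX.
have : ~~ indep (matroid_of L) (c |: X).
  by apply: contra cX => /mX <-; rewrite ?setU11 // subsetUr.
have [/existsP[x /and4P[xL sx x0 xc]] _|/existsPn h] := boolP
  [exists x : vec, [&& x \in L, supp x \subset c |: X, x != 0 & x c != 0]].
  by exists x.
case/negP; apply/indep_matroid_ofP => x xL sx; apply/eqP/negPn/negP => x0.
have := h x; rewrite xL sx x0 negbK => /eqP xc.
case/eqP: x0; apply: iX => //; apply/subsetP => v vx.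
have := subsetP sx v vx; rewrite !inE => /orP[/eqP e|//].
by move: vx; rewrite inE e xc eqxx.
Qed.

Lemma sum_supp_image m (g : 'I_m -> V) (a : V -> F) x :
    injective g -> supp x \subset g @: setT ->
  \sum_v a v * x v = \sum_k a (g k) * x (g k).
Proof.
move=> inj_g sx; rewrite (bigID (mem (g @: setT))) /= [X in _ + X]big1 ?addr0.
  rewrite big_imset /=; last by move=> ? ? _ _ /inj_g.
  by apply: eq_bigl => k; rewrite inE.
by move=> v /(notin_supp sx)->; rewrite mulr0.
Qed.

(** [G] is a parity-check matrix of [L] of full row rank [r]. *)
Variables (L : {vspace vec}) (r : nat) (G : 'I_r -> V -> F).
Hypothesis memL : forall x,
  reflect (forall i, \sum_v G i v * x v = 0) (x \in L).
Hypothesis freeG : forall y : 'I_r -> F,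
  (forall v, \sum_i y i * G i v = 0) -> forall i, y i = 0.

(** A linear relation among the columns [g k] of [G], extended by zero off the image of [g], is a
    vector of [L]. *)
Lemma indep_row_free m (g : 'I_m -> V) : injective g ->
  indep (matroid_of L) (g @: setT) = row_free (\matrix_(k, i) G i (g k)).
Proof.
move=> inj_g.
have mulE (u : 'rV[F]_m) x : (forall k, x (g k) = u 0 k) ->
    supp x \subset g @: setT -> u *m (\matrix_(k, i) G i (g k)) = 0 <-> x \in L.
  move=> xu sx; have e i : (u *m (\matrix_(k, i) G i (g k))) 0 i =
      \sum_v G i v * x v.
    rewrite (sum_supp_image _ inj_g sx) mxE; apply: eq_bigr => k _.
    by rewrite mxE xu mulrC.
  split=> [u0|/memL xL]; first by apply/memL => i; rewrite -e u0 mxE.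
  by apply/rowP => i; rewrite e xL mxE.
apply/indep_matroid_ofP/idP => [h|fr x xL sx].
  apply: inj_row_free => u u0.
  (* Injectivity of [g] leaves at most one term; off the image the empty sum gives 0. *)
  pose x : vec := [ffun v => \sum_(k | g k == v) u 0 k].
  have xu k : x (g k) = u 0 k.
    by rewrite ffunE (big_pred1 k) // => j; rewrite (inj_eq inj_g).
  have sx : supp x \subset g @: setT.
    apply/subsetP => v; rewrite inE; apply: contraNT => vg.
    rewrite ffunE big1 // => k /eqP kv; case/negP: vg.
    by rewrite -kv imset_f.
  have x0 := h x (proj1 (mulE u x xu sx) u0) sx.
  by apply/rowP => k; rewrite -xu x0 ffunE mxE.
have /(mulE (\row_k x (g k)) x) : x \in L by [].
move=> /(_ (fun k => esym (mxE _ _ _ _)) sx)/eqP.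
rewrite mulmx_free_eq0 // => /eqP/rowP u0.
apply/ffunP => v; rewrite ffunE.
have [/imsetP[k _ ->]|vg] := boolP (v \in g @: setT).
  by have := u0 k; rewrite !mxE.
exact: notin_supp vg.
Qed.

(** The columns in [X] are independent, so their rank is [#|X|]. It is also [r], because a
    combination of rows of [G] vanishing on [X] vanishes everywhere. *)
Lemma card_base X : X \in bases (matroid_of L) -> #|X| = r.
Proof.
move=> bX; pose g (k : 'I_#|X|) : V := enum_val k.
have inj_g : injective g by apply: enum_val_inj.
have gX : g @: setT = X.
  apply/eqP; rewrite eqEcard card_imset // cardsT card_ord leqnn andbT.
  by apply/subsetP=> _ /imsetP[i _ ->]; apply: enum_valP.
have : indep (matroid_of L) (g @: setT).
  by rewrite gX; apply/indepP; exists X.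
rewrite indep_row_free // => /eqP <-; rewrite -mxrank_tr; apply/eqP.
apply: inj_row_free => y y0.
have phi0 v : \sum_i y 0 i * G i v = 0.
  have {}y0 w : w \in X -> \sum_i y 0 i * G i w = 0.
    rewrite -gX => /imsetP[k _ ->]; have /rowP/(_ k) := y0; rewrite !mxE.
    by move=> e; rewrite -[RHS]e; apply: eq_bigr => i _; rewrite !mxE.
  have [/y0//|vX] := boolP (v \in X).
  (* The row combination is orthogonal to [x], and only the term at [v] survives in the pairing. *)
  have [x [/memL xL sx xv]] := fundamental_vector bX vX.
  have : \sum_w (\sum_i y 0 i * G i w) * x w = 0.
    under eq_bigr do rewrite big_distrl /=.
    rewrite exchange_big big1 //= => i _.
    transitivity (y 0 i * \sum_w G i w * x w); last by rewrite xL mulr0.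
    by rewrite big_distrr /=; apply: eq_bigr => w _; rewrite mulrA.
  rewrite (bigD1 v) //= [X in _ + X]big1 ?addr0 => [/eqP|w wv].
    by rewrite mulf_eq0 (negPf xv) orbF => /eqP.
  have [/y0->|wX] := boolP (w \in X); first by rewrite mul0r.
  by rewrite (notin_supp sx) ?mulr0 // !inE negb_or wv.
by apply/rowP => i; rewrite (freeG (y := y 0) phi0) mxE.
Qed.

(** All bases have [r] elements, so an independent set of that size is a base. *)
Lemma base_det (g : 'I_r -> V) : injective g ->
  (g @: setT \in bases (matroid_of L)) = (\det (\matrix_(k, i) G i (g k)) != 0).
Proof.
move=> inj_g; rewrite -unitfE -unitmxE -row_free_unit -indep_row_free //.
apply/idP/indepP => [bg|[Y bY sgY]]; first by exists (g @: setT).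
suff -> : g @: setT = Y by [].
apply/eqP; rewrite eqEcard sgY (card_base bY) card_imset //.
by rewrite cardsT card_ord leqnn.
Qed.

End RepresentedBases.

(** * The Hermitian form over GF(4) and the bicycle matroid *)

Section Bicycle.
Local Open Scope ring_scope.
Variables (F : finFieldType) (V : finType).
Hypothesis F4 : #|F| = 4%N.
Notation vec := {ffun V -> F^o}.
Implicit Types (x y z w : vec) (L : {vspace vec}) (X : {set V}).

Let F2 : 2%N \in [pchar F].
Proof. exact: (@card_finPcharP _ 2 2). Qed.

Let expF4 (a : F) : a ^+ 4 = a.
Proof. by rewrite -[RHS]expf_card F4. Qed.

Let sqrD : {morph (fun a : F => a ^+ 2) : a b / a + b}.
Proof. by move=> a b; apply: (pFrobenius_autD_comm F2 (mulrC _ _)). Qed.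

Let sqr_sum (I : finType) (f : I -> F) :
  (\sum_i f i) ^+ 2 = \sum_i f i ^+ 2.
Proof. exact: (big_morph (fun a : F => a ^+ 2) sqrD (expr0n _ 2)). Qed.

(** This turns the product of a minor and its conjugate into the indicator of a base. *)
Let cubeE (a : F) : a ^+ 2 * a = (a != 0)%:R.
Proof.
have [->|a0] := eqVneq a 0; first by rewrite mulr0.
by apply: (mulIf a0); rewrite mul1r -!exprSr expF4.
Qed.

(** The rows of [A] themselves lie in [perp (ker A)], so orthogonality to that space forces
    membership in the kernel. *)
Lemma perp_ker_sum (I : finType) (A : I -> V -> F) x :
  reflect (forall w, w \in perp (ker A) -> \sum_v w v * x v = 0) (x \in ker A).
Proof.
apply: (iffP idP) => [xL w|h].
  rewrite mem_perp => /forall_inP/(_ x xL)/eqP dxw.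
  by rewrite -[RHS]dxw; apply: eq_bigr => v _; rewrite mulrC.
rewrite mem_ker; apply/forallP => i; apply/eqP.
have e : \sum_v [ffun v => A i v : F^o] v * x v = 0.
  apply: h; rewrite mem_perp; apply/forall_inP => y.
  rewrite mem_ker => /forallP/(_ i)/eqP e; apply/eqP; rewrite -[RHS]e.
  by apply: eq_bigr => v _; rewrite ffunE mulrC.
by rewrite -[RHS]e; apply: eq_bigr => v _; rewrite ffunE.
Qed.

Definition restr X z : vec := [ffun v => if v \in X then z v else 0].

(* [X] is nondegenerate when the Hermitian form restricted to the coordinates
   in [X] is nondegenerate on the row space of the representation. *)
Definition nondegenerate L X : Prop :=
  forall z, z \in invv (perp L) -> restr X z \in L -> z = 0.

Section Parity.
Variables (L : {vspace vec}) (r : nat) (G : 'I_r -> V -> F).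
Hypothesis memL : forall x,
  reflect (forall i, \sum_v G i v * x v = 0) (x \in L).
Hypothesis freeG : forall y : 'I_r -> F,
  (forall v, \sum_i y i * G i v = 0) -> forall i, y i = 0.
Hypothesis perpG : forall w, w \in perp L ->
  exists y : 'I_r -> F, forall v, w v = \sum_i y i * G i v.

(** Restriction to [X] and conjugation both sit in the first factor, so Cauchy-Binet applies with
    [G] as the second. *)
Let gram X : 'M[F]_r :=
  \matrix_(i, j) \sum_v (if v \in X then G i v ^+ 2 else 0) * G j v.

Lemma loopcV_gram X :
  (X \in loopcV (bases (matroid_of L))) = (\det (gram X) != 0).
Proof.
pose c (Z : {set V}) : F :=
  ((Z \in bases (matroid_of L)) && (Z \subset X))%:R.
rewrite (@cauchy_binet _ _ _ _ _ c) => [|Z|g inj_g].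
(* In characteristic 2 the sum of the indicators [c Z] retains exactly the parity of the number of
   bases inside [X]. *)
- rewrite -natr_sum -(dvdn_pcharf F2) dvdn2 negbK inE; congr odd.
  rewrite -sum1_card big_mkcond /=; apply: eq_bigr => Z _.
  by rewrite inE; case: (_ && _).
- apply: contraNeq; rewrite /c; case: andP => [[/(card_base memL freeG)-> _]|].
    by rewrite eqxx.
  by rewrite eqxx.
rewrite /c (base_det memL freeG inj_g) -det_tr.
have -> : (\matrix_(k, i) G i (g k))^T = \matrix_(i, j) G i (g j).
  by apply/matrixP => i j; rewrite !mxE.
set D := \matrix_(i, j) G i (g j).
have [sgX|/subsetPn[_ /imsetP[j _ ->] jX]] := boolP (g @: setT \subset X).
  (* The Frobenius automorphism commutes with the determinant, so the first minor is the square of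
     the second. *)
  have -> : (\matrix_(i, j) (if g j \in X then G i (g j) ^+ 2 else 0)) =
            map_mx (pFrobenius_aut F2) D.
    apply/matrixP => i j; rewrite !mxE (subsetP sgX) ?imset_f //.
  by rewrite det_map_mx andbT -cubeE.
(* Column [j] is zero because [g j] lies outside [X]. *)
rewrite andbF (expand_det_col _ j) big1 ?mul0r // => i _.
by rewrite mxE (negPf jX) mul0r.
Qed.

(** The combinations [z] of conjugated rows of [G] fill [invv (perp L)], and [restr X z] lies in [L]
    exactly when the coefficient vector is in the left kernel of [gram X]. *)
Lemma loopcV_nondegenerate X :
  X \in loopcV (bases (matroid_of L)) <-> nondegenerate L X.
Proof.
rewrite loopcV_gram -unitfE -unitmxE -row_free_unit.
have gramE (u : 'rV[F]_r) z :
    (forall v, z v = \sum_i u 0 i * G i v ^+ 2) ->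
    u *m gram X = 0 <-> restr X z \in L.
  move=> zu; have e j : (u *m gram X) 0 j = \sum_v G j v * restr X z v.
    rewrite mxE; under eq_bigr do rewrite mxE big_distrr /=.
    rewrite exchange_big; apply: eq_bigr => v _; rewrite ffunE /=.
    case: ifP => _; last by rewrite mulr0 big1 // => i _; rewrite mul0r mulr0.
    by rewrite zu big_distrr; apply: eq_bigr => i _ /=; rewrite mulrA mulrC.
  split=> [u0|/memL zL]; first by apply/memL => i; rewrite -e u0 mxE.
  by apply/rowP => i; rewrite e zL mxE.
split=> [fr z /(mem_invv _ _ F4)[w /perpG[y wE] ->] zL|nd].
  pose u : 'rV[F]_r := \row_i y i ^+ 2.
  have zu v : Defs.inv w v = \sum_i u 0 i * G i v ^+ 2.
    rewrite ffunE wE sqr_sum; apply: eq_bigr => i _.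
    by rewrite exprMn mxE.
  have /eqP := proj2 (gramE u _ zu) zL; rewrite mulmx_free_eq0 // => /eqP u0.
  apply/ffunP => v; rewrite zu u0 big1 ?ffunE // => i _.
  by rewrite mxE mul0r.
apply: inj_row_free => u u0.
(* The coefficients are squared so that conjugating [w] gives back [u], as [a ^+ 4 = a]. *)
pose w : vec := [ffun v => \sum_i u 0 i ^+ 2 * G i v].
have zu v : Defs.inv w v = \sum_i u 0 i * G i v ^+ 2.
  rewrite !ffunE sqr_sum; apply: eq_bigr => i _.
  by rewrite exprMn -exprM expF4.
have wL : w \in perp L.
  rewrite mem_perp; apply/forall_inP => x /memL xL; rewrite /dot.
  under eq_bigr do rewrite ffunE big_distrr /=.
  rewrite exchange_big big1 //= => i _.
  transitivity (u 0 i ^+ 2 * \sum_v G i v * x v); last by rewrite xL mulr0.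
  by rewrite big_distrr /=; apply: eq_bigr => v _; rewrite mulrC mulrA.
have /ffunP z0 : Defs.inv w = 0.
  apply: nd; last exact/(gramE u).
  by apply/(mem_invv _ _ F4); exists w.
have w0 v : \sum_i u 0 i ^+ 2 * G i v = 0.
  by apply/eqP; have /eqP := z0 v; rewrite !ffunE expf_eq0.
apply/rowP => i; apply/eqP; rewrite mxE.
by have /eqP := freeG w0 i; rewrite expf_eq0.
Qed.

End Parity.

(** A bicycle supported in [X] is its own restriction to [X]. *)
Lemma nondegenerate_indep L X :
  nondegenerate L X -> indep (matroid_of (bicycle L)) X.
Proof.
move=> nd; apply/indep_matroid_ofP => z; rewrite memv_cap => /andP[zL zP] sz.
apply: nd => //; suff -> : restr X z = z by [].
apply/ffunP => v; rewrite ffunE; case: ifPn => // vX.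
by rewrite (notin_supp sz).
Qed.

(* If [z] lies in the row space and its restriction [z|X] in [L], then every
   bicycle is orthogonal to both, hence to [z - z|X]; the bicycles supported on
   [c |: X] for [c] outside [X] then force [z] to vanish off [X]. *)
Lemma bicycle_base_nondegenerate L X :
  X \in bases (matroid_of (bicycle L)) -> nondegenerate L X.
Proof.
move=> bX z zP zL; have zC c : c \notin X -> z c = 0.
  move=> cX; have [b [bBC sb bc]] := fundamental_vector bX cX.
  move: bBC; rewrite memv_cap => /andP[bL /(mem_invv _ _ F4)[b' b'P bE]].
  have b2 v : b v ^+ 2 = b' v by rewrite bE ffunE -exprM expF4.
  (* This is the conjugate of the orthogonality of [b] in [L] to [w] in [perp L], where [z] is the
     conjugate of [w]. *)
  have s1 : \sum_v b v ^+ 2 * z v = 0.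
    have [w wP zE] := mem_invv _ _ F4 zP.
    move: wP; rewrite mem_perp => /forall_inP/(_ b bL)/eqP bw.
    transitivity (dot b w ^+ 2); last by rewrite bw expr0n.
    by rewrite sqr_sum; apply: eq_bigr => v _; rewrite zE ffunE exprMn.
  have s2 : \sum_v b v ^+ 2 * restr X z v = 0.
    move: b'P; rewrite mem_perp => /forall_inP/(_ _ zL)/eqP d.
    by rewrite -[RHS]d; apply: eq_bigr => v _; rewrite b2 mulrC.
  have : \sum_v b v ^+ 2 * (z v - restr X z v) = 0.
    by under eq_bigr do rewrite mulrBr; rewrite sumrB s1 s2 subrr.
  (* Only [c] contributes: [b] vanishes off [c |: X], and the difference vanishes on [X]. *)
  rewrite (bigD1 c) //= big1 ?addr0 => [/eqP|v vc].
    by rewrite ffunE (negPf cX) subr0 mulf_eq0 expf_eq0 (negPf bc) => /eqP.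
  rewrite ffunE; case: ifPn => [_|vX]; first by rewrite subrr mulr0.
  by rewrite (notin_supp sb) ?expr0n ?mul0r // !inE negb_or vc.
(* Now [z] is itself a bicycle supported in the independent set [X], hence zero. *)
have rz : restr X z = z.
  by apply/ffunP => v; rewrite ffunE; case: ifPn => // /zC.
move: bX; rewrite inE => /maxsetp/indep_matroid_ofP; apply.
  by rewrite memv_cap zP -rz zL.
by apply/subsetP => v; rewrite inE; apply: contraNT => /zC->.
Qed.

Lemma bicycle_bases (I : finType) (A : I -> V -> F) :
  bases (matroid_of (bicycle (ker A))) =
  maxsys (loopcV (bases (matroid_of (ker A)))).
Proof.
set L := ker A; pose G (i : 'I_(\dim (perp L))) v : F := (vbasis (perp L))`_i v.
have Gv (y : 'I_(\dim (perp L)) -> F) v : \sum_i y i * G i v =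
    (\sum_i y i *: (vbasis (perp L))`_i) v.
  by rewrite sum_ffunE; apply: eq_bigr => i _; rewrite !ffunE.
have perpG w : w \in perp L ->
    exists y : 'I_(\dim (perp L)) -> F, forall v, w v = \sum_i y i * G i v.
  move=> wP; exists (fun i => coord (vbasis (perp L)) i w) => v.
  by rewrite Gv -coord_vbasis.
have memL x : reflect (forall i, \sum_v G i v * x v = 0) (x \in L).
  apply: (iffP (perp_ker_sum A x)) => h => [i|w /perpG[y wE]].
    by apply: h; apply: vbasis_mem; rewrite mem_nth // size_tuple.
  under eq_bigr do rewrite wE big_distrl /=.
  rewrite exchange_big big1 //= => i _.
  transitivity (y i * \sum_v G i v * x v); last by rewrite h mulr0.
  by rewrite big_distrr /=; apply: eq_bigr => v _; rewrite mulrA.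
have freeG (y : 'I_(\dim (perp L)) -> F) :
    (forall v, \sum_i y i * G i v = 0) -> forall i, y i = 0.
  move=> y0; have /freeP := basis_free (vbasisP (perp L)); apply.
  by apply/ffunP => v; rewrite -Gv y0 ffunE.
have E X := loopcV_nondegenerate memL freeG perpG X.
(* Bases of the bicycle matroid are nondegenerate and nondegenerate sets are independent in it, so
   the two families have the same maximal members. *)
apply/setP => X; rewrite [in RHS]inE; apply/idP/maxsetP => [bX|[XE mX]].
  split=> [|Y YE sXY]; first exact/E/bicycle_base_nondegenerate.
  move: bX; rewrite inE => /maxsetP[_]; apply=> //.
  exact/nondegenerate_indep/E.
have /indepP[Y bY sXY] := nondegenerate_indep (proj1 (E X) XE).
by rewrite -(mX Y) //; apply/E/bicycle_base_nondegenerate.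
Qed.

End Bicycle.

Theorem theorem9 (F : finFieldType) (F4 : #|F| = 4) (V : finType)
    (M : matroid V) (I : finType) (A : I -> V -> F)
    (hA : M = matroid_of (ker A)) :
  bases (matroid_of (bicycle (ker A))) = maxsys (loopcV (bases M))
  /\ (forall (J : finType) (B : J -> V -> F), M = matroid_of (ker B) ->
       matroid_of (bicycle (ker B)) = matroid_of (bicycle (ker A))).
Proof.
split=> [|J B hB]; first by rewrite hA (bicycle_bases F4 A).
by apply: bases_inj; rewrite (bicycle_bases F4 B) (bicycle_bases F4 A) -hA -hB.
Qed.
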